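(* For any normal affine semigroup $H\in\mathcal N_2$ in $\mathbb N^2$, the set $\omega_H$ has a unique minimal element with respect to the componentwise partial ordering.
   Context: $\mathbb N=\{0,1,2,\dots\}$. $\mathcal N_2$ is the class of normal affine semigroups $H\subseteq\mathbb N^2$ generating $\mathbb Z^2$ as a group: $H$ is a finitely generated submonoid of $\mathbb N^2$ with $H=C\cap\mathbb Z^2$, where $C\subseteq\mathbb R^2$ is the (two-dimensional) cone generated by $H$. Put $\omega_H=\mathbb Z^2\cap\operatorname{relint}C$. *)

(* Defs.v *)
From HB Require Import structures.
From mathcomp Require Import all_boot all_order all_algebra.
From mathcomp Require Import all_classical all_reals all_analysis.
Import Order.TTheory GRing.Theory Num.Theory.
Import numFieldNormedType.Exports.

Set Implicit Arguments.
Unset Strict Implicit.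
Unset Printing Implicit Defensive.

Local Open Scope classical_set_scope.
Local Open Scope ring_scope.

Definition submonoid_generated (V : zmodType) (A : set V) : set V :=
  smallest [set M : set V | addr_closed [in M]] A.

Definition subgroup_generated (V : zmodType) (A : set V) : set V :=
  smallest [set M : set V | zmod_closed [in M]] A.

Definition real_vector (R : realType) {n : nat} (z : 'rV[int]_n) : 'rV[R]_n :=
  map_mx intr z.

Definition cone (R : realType) (n : nat) (A : set 'rV[R]_n) : set 'rV[R]_n :=
  [set x | exists k (a : 'I_k -> R) (v : 'I_k -> 'rV[R]_n),
    [/\ forall i, 0 <= a i, forall i, A (v i) & x = \sum_(i < k) a i *: v i]].

Definition affine_hull (R : realType) (n : nat) (A : set 'rV[R]_n) :
    set 'rV[R]_n :=
  [set x | exists k (a : 'I_k -> R) (v : 'I_k -> 'rV[R]_n),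
    [/\ \sum_(i < k) a i = 1, forall i, A (v i)
      & x = \sum_(i < k) a i *: v i]].

(* The interior of [A] for the subspace topology of its affine hull. *)
Definition relint (R : realType) (n : nat) (A : set 'rV[R]_n) : set 'rV[R]_n :=
  [set x | A x /\ within (affine_hull A) (nbhs x) A].

Definition cone_of (R : realType) (n : nat) (H : set 'rV[int]_n) :
    set 'rV[R]_n :=
  cone (real_vector R @` H).
Arguments cone_of R {n} H _.

(* The class N_2; N^2 is the set of integer vectors with nonnegative
   coordinates.  The cone is two-dimensional because [H] generates Z^2. *)
Definition normal_semigroup2 (R : realType) (H : set 'rV[int]_2) : Prop :=
  [/\ forall h, H h -> forall j, 0 <= h 0 j,
      exists2 A : set 'rV[int]_2, finite_set A & H = submonoid_generated A,
      subgroup_generated H = [set: 'rV[int]_2]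
    & H = real_vector R @^-1` cone_of R H].

Definition omega (R : realType) (n : nat) (H : set 'rV[int]_n) :
    set 'rV[int]_n :=
  real_vector R @^-1` relint (cone_of R H).

Definition componentwise_le (n : nat) (x y : 'rV[int]_n) : Prop :=
  forall j, x 0 j <= y 0 j.

Definition minimal_element (n : nat) (A : set 'rV[int]_n) (m : 'rV[int]_n) :
    Prop :=
  A m /\ forall x, A x -> componentwise_le x m -> x = m.

(* Main.v *)
(** Because the cone lies in the first quadrant, its interior is closed under
    componentwise minimum: if [x = (a, b)] and [y = (c, d)] are interior with
    [a < c] and [d < b], then [(a, d)] is the positive combination
    [(d (c - a) x + a (b - d) y) / (b c - a d)] of [x] and [y].  Hence [omega]
    is a nonempty set of nonnegative vectors closed under componentwise
    minimum, and an element of smallest coordinate sum is its least element. *)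

Require Import Defs.
From mathcomp Require Import all_boot all_order all_algebra.
From mathcomp Require Import all_classical all_reals all_analysis.
From mathcomp Require Import ring lra.
Import Order.TTheory GRing.Theory Num.Theory.
Import numFieldNormedType.Exports.

Set Implicit Arguments.
Unset Strict Implicit.
Unset Printing Implicit Defensive.

Local Open Scope classical_set_scope.
Local Open Scope ring_scope.

Lemma cone0 (R : realType) n (A : set 'rV[R]_n) : cone A 0.
Proof.
exists 0%N, (fun=> 0), (fun=> 0).
by split=> [[]//|[]//|]; rewrite big_ord0.
Qed.

Lemma sub_cone (R : realType) n (A : set 'rV[R]_n) : A `<=` cone A.
Proof.
by move=> x Ax; exists 1%N, (fun=> 1), (fun=> x); split=> //;
  rewrite big_ord1 scale1r.
Qed.

Lemma coneZ (R : realType) n (A : set 'rV[R]_n) c x :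
  0 <= c -> cone A x -> cone A (c *: x).
Proof.
move=> c0 [k [a [v [a0 Av ->]]]]; exists k, (fun i => c * a i), v; split=> //.
  by move=> i; rewrite mulr_ge0.
by rewrite scaler_sumr; apply: eq_bigr => i _; rewrite scalerA.
Qed.

Lemma coneD (R : realType) n (A : set 'rV[R]_n) x y :
  cone A x -> cone A y -> cone A (x + y).
Proof.
move=> [k [a [v [a0 Av ->]]]] [l [b [w [b0 Aw ->]]]].
exists (k + l)%N,
  (fun i => match fintype.split i with inl j => a j | inr j => b j end),
  (fun i => match fintype.split i with inl j => v j | inr j => w j end).
split=> [i|i|]; [by case: fintype.split|by case: fintype.split|].
rewrite big_split_ord /=; congr (_ + _); apply: eq_bigr => i _.
  by rewrite -[lshift l i]/(unsplit (inl i)) unsplitK.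
by rewrite -[rshift k i]/(unsplit (inr i)) unsplitK.
Qed.

Lemma cone_ge0 (R : realType) n (A : set 'rV[R]_n) :
  (forall x, A x -> forall j, 0 <= x 0 j) ->
  forall x, cone A x -> forall j, 0 <= x 0 j.
Proof.
move=> A0 x [k [a [v [a0 Av ->]]]] j; rewrite summxE.
by apply: sumr_ge0 => i _; rewrite mxE mulr_ge0 // A0.
Qed.

(** The continuous map [f] inverts [w] ↦ [a *: w + b *: y] and sends the given point to [x]. So the
    preimage of the cone under [f] is a neighbourhood, and each of its points
    [z = a *: f z + b *: y] is in the cone. *)
Lemma nbhs_cone_comb (R : realType) n (A : set 'rV[R]_n) (x y : 'rV[R]_n)
    (a b : R) :
  0 < a -> 0 <= b -> nbhs x (cone A) -> cone A y ->
  nbhs (a *: x + b *: y) (cone A).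
Proof.
move=> a0 b0 Cx Cy.
have a_neq0 : a != 0 by rewrite gt_eqF.
pose f (z : 'rV[R]_n) := a^-1 *: (z - b *: y).
have fE : f (a *: x + b *: y) = x by rewrite /f addrK scalerA mulVf ?scale1r.
have cf w : f z @[z --> w] --> f w.
  exact: cvgZl_tmp (cvgB cvg_id (cvg_cst _)).
have : nbhs (a *: x + b *: y) (f @^-1` cone A) by apply: cf; rewrite fE.
apply: filterS => z /= Cfz.
rewrite (_ : z = a *: f z + b *: y); last first.
  by rewrite /f scalerA divff // scale1r subrK.
by apply: coneD; apply: coneZ => //; exact: ltW.
Qed.

(** Lowering every coordinate of an interior point by half the radius of a ball inside the cone
    stays in the cone, where coordinates are nonnegative. *)
Lemma nbhs_cone_gt0 (R : realType) n (A : set 'rV[R]_n) :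
  (forall x, A x -> forall j, 0 <= x 0 j) ->
  forall x : 'rV[R]_n, nbhs x (cone A) -> forall j, 0 < x 0 j.
Proof.
move=> A0 x /nbhs_ballP[e /= e0 Ce] j.
have /(cone_ge0 A0)/(_ j) : cone A (x - const_mx (e / 2)).
  apply: Ce; split=> // i k; rewrite !mxE /ball /=.
  by rewrite opprB addrCA subrr addr0 gtr0_norm; lra.
by rewrite !mxE; lra.
Qed.

(** Cramer's rule for [(a, d)] in terms of [(a, b)] and [(c, d)]; the determinant [b * c - a * d] is
    positive since [0 < a < c] and [0 < d < b]. *)
Lemma min_positive_comb (R : realFieldType) (a b c d : R) :
  0 < a -> 0 < d -> a < c -> d < b ->
  exists2 p : R * R, 0 < p.1 /\ 0 < p.2
    & p.1 * a + p.2 * c = a /\ p.1 * b + p.2 * d = d.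
Proof.
move=> a0 d0 ac db.
have D0 : 0 < b * c - a * d by nra.
exists (d * (c - a) / (b * c - a * d), a * (b - d) / (b * c - a * d)) => /=.
  by split; rewrite divr_gt0 // mulr_gt0 // subr_gt0.
by split; field; rewrite gt_eqF.
Qed.

Lemma row2P (T : Type) (x y : 'rV[T]_2) :
  x 0 0 = y 0 0 -> x 0 1 = y 0 1 -> x = y.
Proof.
move=> e0 e1; apply/rowP => -[[|[|//]] i2].
  by rewrite (_ : Ordinal i2 = 0) //; exact: val_inj.
by rewrite (_ : Ordinal i2 = 1) //; exact: val_inj.
Qed.

Lemma nbhs_cone_min (R : realType) (A : set 'rV[R]_2) :
  (forall x, A x -> forall j, 0 <= x 0 j) ->
  forall x y : 'rV[R]_2, nbhs x (cone A) -> nbhs y (cone A) ->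
  nbhs (map2_mx Num.min x y) (cone A).
Proof.
move=> A0.
suff wlogc (x y : 'rV[R]_2) : x 0 0 <= y 0 0 ->
    nbhs x (cone A) -> nbhs y (cone A) -> nbhs (map2_mx Num.min x y) (cone A).
  move=> x y Cx Cy; case: (leP (x 0 0) (y 0 0)) => [|/ltW] xy.
    exact: wlogc.
  rewrite (_ : map2_mx _ _ _ = map2_mx Num.min y x); first exact: wlogc.
  by apply/rowP => j; rewrite !mxE minC.
move=> xy0 Cx Cy; case: (leP (x 0 1) (y 0 1)) => xy1.
  by rewrite (_ : map2_mx _ _ _ = x) //; apply: row2P; rewrite mxE min_l.
(* Now [y 0 1 < x 0 1]. Equal first coordinates make [y] the minimum; they are split off because the
   combination needs both inequalities strict. *)
have [xyE|xyN] := eqVneq (x 0 0) (y 0 0).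
  rewrite (_ : map2_mx _ _ _ = y) //.
  by apply: row2P; rewrite mxE min_r // ?xyE // ltW.
have xy0' : x 0 0 < y 0 0 by rewrite lt_neqAle xyN.
have [[p q] /= [p0 q0] [e0 e1]] := min_positive_comb
  (nbhs_cone_gt0 A0 Cx 0) (nbhs_cone_gt0 A0 Cy 1) xy0' xy1.
rewrite (_ : map2_mx _ _ _ = p *: x + q *: y).
  by apply: nbhs_cone_comb => //; [exact: ltW|exact: nbhs_singleton].
by apply: row2P; rewrite !mxE; [rewrite min_l|rewrite min_r // ltW].
Qed.

(** The determinant with rows [u] and [v], over any commutative ring so that it serves both integer
    and real vectors. *)
Definition cross (V : comRingType) (u v : 'rV[V]_2) : V :=
  u 0 0 * v 0 1 - u 0 1 * v 0 0.

(** Cramer's rule in the basis [u], [v]. *)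
Lemma cross_coord (K : fieldType) (u v z : 'rV[K]_2) : cross u v != 0 ->
  z = (cross z v / cross u v) *: u + (cross u z / cross u v) *: v.
Proof. by rewrite /cross => D0; apply: row2P; rewrite !mxE; field. Qed.

(** The apex [0] lies in the cone and can carry the weight [1 - a - b], so every linear combination
    of [u] and [v] is also an affine one. *)
Lemma affine_hull_coneT (R : realType) (A : set 'rV[R]_2) (u v : 'rV[R]_2) :
  A u -> A v -> cross u v != 0 -> affine_hull (cone A) = setT.
Proof.
move=> Au Av D0; apply/seteqP; split=> // z _.
pose a := cross z v / cross u v; pose b := cross u z / cross u v.
exists 3%N, (tnth [tuple a; b; 1 - a - b]), (tnth [tuple u; v; 0]); split.
- by rewrite !big_ord_recl big_ord0 !(tnth_nth 0) /=; ring.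
- by case=> [[|[|[|//]]] i3]; rewrite (tnth_nth 0) /=;
    [exact: sub_cone|exact: sub_cone|exact: cone0].
- rewrite !big_ord_recl big_ord0 !(tnth_nth 0) /= scaler0 !addr0.
  exact: cross_coord.
Qed.

Lemma relint_coneE (R : realType) (A : set 'rV[R]_2) (u v : 'rV[R]_2) :
  A u -> A v -> cross u v != 0 ->
  relint (cone A) = [set x : 'rV[R]_2 | nbhs x (cone A)].
Proof.
move=> Au Av D0; rewrite /relint (affine_hull_coneT Au Av D0).
apply/seteqP; split=> x /=; rewrite withinET; first by case.
by move=> Cx; split=> //; exact: nbhs_singleton.
Qed.

(** The coordinates of [z] in the basis [u], [v] are continuous in [z] and both equal 1 at [u + v],
    so they stay positive nearby. *)
Lemma nbhs_cone_add (R : realType) (A : set 'rV[R]_2) (u v : 'rV[R]_2) :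
  A u -> A v -> cross u v != 0 -> nbhs (u + v) (cone A).
Proof.
move=> Au Av D0.
have coord j : (z : 'rV[R]_2) 0 j @[z --> u + v] --> (u + v) 0 j.
  exact: coord_continuous.
have cvg1 : (cross z v / cross u v) @[z --> u + v] -->
    cross (u + v) v / cross u v.
  exact: cvgMr_tmp (cvgB (cvgMr_tmp (coord _)) (cvgMr_tmp (coord _))).
have cvg2 : (cross u z / cross u v) @[z --> u + v] -->
    cross u (u + v) / cross u v.
  exact: cvgMr_tmp (cvgB (cvgMl_tmp (coord _)) (cvgMl_tmp (coord _))).
have e1 : cross (u + v) v / cross u v = 1.
  by move: D0; rewrite /cross => D0; rewrite !mxE; field.
have e2 : cross u (u + v) / cross u v = 1.
  by move: D0; rewrite /cross => D0; rewrite !mxE; field.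
rewrite e1 in cvg1; rewrite e2 in cvg2.
near=> z; rewrite [z](cross_coord _ D0).
apply: coneD; apply: coneZ; try exact: sub_cone.
  near: z; apply: filterS (cvgr_gt _ cvg1 _ ltr01) => z; exact: ltW.
near: z; apply: filterS (cvgr_gt _ cvg2 _ ltr01) => z; exact: ltW.
Unshelve. all: by end_near. Qed.

(** Otherwise any two elements of [H] are parallel. Two passes through the generated group then
    force [H] into [{0}] and the whole lattice into [{0}]. *)
Lemma generated_cross_neq0 (H : set 'rV[int]_2) :
  subgroup_generated H = setT ->
  exists u v, [/\ H u, H v & cross u v != 0].
Proof.
move=> genH; apply: contrapT => nex.
have gen_sub M : zmod_closed [in M] -> H `<=` M -> forall z, M z.
  move=> Mz HM z; have : subgroup_generated H z by rewrite genH.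
  exact.
(* The vectors parallel to all of [H] form a subgroup containing [H], hence are all vectors. *)
pose M : set 'rV[int]_2 := [set z | forall u, H u -> cross u z = 0].
have MT z : M z.
  apply: (gen_sub M) => [|u Hu v Hv]; last first.
    by apply: contrapT => /eqP uv; apply: nex; exists v, u.
  split=> [|x y]; rewrite !inE /=.
    by move=> u _; rewrite /cross !mxE; ring.
  move=> x0 y0 u Hu; rewrite -[RHS](subrr 0) -{1}(x0 u Hu) -(y0 u Hu).
  by rewrite /cross !mxE; ring.
have H0 z : [set 0 : 'rV[int]_2] z.
  apply: (gen_sub [set 0]) => [|u Hu /=].
    by split=> [|x y]; rewrite !inE //= => -> ->; rewrite subr0.
  (* Being parallel to both unit vectors kills both coordinates of [u]. *)
  have := MT (delta_mx 0 0) u Hu; have := MT (delta_mx 0 1) u Hu.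
  rewrite /cross !mxE /= => e0 e1.
  by apply: row2P; rewrite mxE; lra.
by have /rowP/(_ 0) := H0 (const_mx 1); rewrite !mxE.
Qed.

(** If [m] has the smallest coordinate sum, its minimum [w] with [x] is again in [S] and cannot have
    a smaller sum. The nonnegative differences [m 0 i - w 0 i] thus sum to 0 and all vanish, so
    [m = w] lies below [x]. *)
Lemma min_closed_least n (S : set 'rV[int]_n) :
  (forall x, S x -> forall j, 0 <= x 0 j) ->
  (forall x y, S x -> S y -> S (map2_mx Num.min x y)) ->
  S !=set0 -> exists2 m, S m & forall x, S x -> componentwise_le m x.
Proof.
move=> S0 Smin [x0 Sx0].
pose P k := `[< exists2 x, S x & \sum_j x 0 j = k%:Z >].
have exP : exists k, P k.
  exists `|(\sum_j x0 0 j)%R|%N; apply/asboolP; exists x0 => //.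
  by rewrite gez0_abs // sumr_ge0 // => j _; exact: S0.
case: (ex_minnP exP) => k /asboolP[m Sm sm] kmin; exists m => // x Sx j.
pose w := map2_mx Num.min m x; have Sw : S w by exact: Smin.
have mw i : 0 <= m 0 i - w 0 i by rewrite subr_ge0 mxE ge_min lexx.
have sw : \sum_i (m 0 i - w 0 i) = 0.
  apply/eqP; rewrite eq_le sumr_ge0 // andbT sumrB sm subr_le0.
  have w0 : 0 <= \sum_i w 0 i by rewrite sumr_ge0 // => i _; exact: S0.
  rewrite -(gez0_abs w0) lez_nat; apply: kmin.
  by apply/asboolP; exists w => //; rewrite gez0_abs.
have mwj : m 0 j - w 0 j = 0.
  exact: (psumr_eq0P (fun i _ => mw i) sw (isT : xpredT j)).
by rewrite (subr0_eq mwj) mxE ge_min lexx orbT.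
Qed.

Lemma least_unique_minimal n (S : set 'rV[int]_n) m :
  S m -> (forall x, S x -> componentwise_le m x) ->
  exists! m, minimal_element S m.
Proof.
move=> Sm mle; exists m; split=> [|x [Sx xmin]]; last exact: xmin (mle x Sx).
split=> // x Sx xm; apply/rowP => j; apply/eqP.
by rewrite eq_le xm // mle.
Qed.

Theorem lemma5p1 (R : realType) (H : set 'rV[int]_2)
    (hH : normal_semigroup2 R H) :
  exists! m : 'rV[int]_2, minimal_element (omega R H) m.
Proof.
case: hH => H0 _ genH _.
have A0 x : (real_vector R @` H) x -> forall j, 0 <= x 0 j.
  by move=> [h Hh <-] j; rewrite mxE ler0z H0.
have [u [v [Hu Hv uv]]] := generated_cross_neq0 genH.
have Au : (real_vector R @` H) (real_vector R u) by exists u.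
have Av : (real_vector R @` H) (real_vector R v) by exists v.
(* The determinant commutes with the embedding of the integers into the reals, which is
   injective. *)
have D0 : cross (real_vector R u) (real_vector R v) != 0.
  by rewrite /cross !mxE -!intrM -intrB intr_eq0.
have omegaE z : omega R H z = nbhs (real_vector R z) (cone_of R H).
  by rewrite /omega /cone_of (relint_coneE Au Av D0).
have [|||m Sm mle] := @min_closed_least _ (omega R H).
- move=> x; rewrite omegaE => /(nbhs_cone_gt0 A0) x0 j.
  by have := x0 j; rewrite mxE ltr0z => /ltW.
- move=> x y; rewrite !omegaE => Cx Cy.
  (* The embedding is monotone, so it commutes with the componentwise minimum. *)
  rewrite (_ : real_vector R _ =
    map2_mx Num.min (real_vector R x) (real_vector R y)).
    exact: nbhs_cone_min.
  by apply/rowP => j; rewrite !mxE !minEle ler_int; case: ifP.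
(* Nonemptiness: the sum of two independent elements of [H] is interior to the cone. *)
- exists (u + v); rewrite omegaE /real_vector map_mxD.
  exact: nbhs_cone_add.
- exact: least_unique_minimal mle.
Qed.
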